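(* Let $n, k$ be positive integers, let $r \in \{1,\dots,k\}$ and let $t$ be an integer with $k < t \le n-k$. Consider the algorithm SINGLE-REF with sampling threshold $t$ and reference rank $r$ for the $k$-secretary problem on $n$ items. For $j \in \{1,\dots,k\}$ let $p_1^{(j)}$ be the probability that SINGLE-REF accepts the best item $v_1$ as its $j$-th accepted item. Then the competitive ratio of SINGLE-REF equals \[ \frac{1}{k} \sum_{j=1}^{k} \gamma_j \, p_1^{(j)}, \qquad \text{where } \gamma_j = \begin{cases} r + 2(j-1) & \text{if } j \le k-r+1, \\ k & \text{otherwise.} \end{cases} \]
   Context: $k$-secretary problem: there are $n$ items with distinct positive values $v_1 > v_2 > \dots > v_n$; item $v_i$ has rank $i$. The items arrive one by one in an order given by a permutation drawn uniformly at random among all $n!$ permutations. An algorithm may accept at most $k$ items; the decision to accept or reject an item is made immediately and irrevocably when it arrives. Let $\mathrm{ALG}$ be the sum of accepted values and $\mathrm{OPT} = \sum_{i=1}^k v_i$. The competitive ratio of an algorithm (for given $n$, $k$) is the infimum over all such item sets of $\mathbb{E}[\mathrm{ALG}]/\mathrm{OPT}$. SINGLE-REF with parameters $t$ (sampling threshold) and $r$ (reference rank): reject the first $t-1$ items (sampling phase); let $s_r$ be the $r$-th best among these $t-1$ items; afterwards accept the first $k$ items (arriving at positions $\ge t$) that are better than $s_r$. *)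

(* Defs.v *)
(* MathComp with MathComp-Analysis (for the infimum over an abstract real type). *)
From mathcomp Require Import all_boot all_order all_fingroup all_algebra.
From mathcomp Require Import classical_sets reals.

Set Implicit Arguments.
Unset Strict Implicit.
Unset Printing Implicit Defensive.

Import Order.TTheory GRing.Theory Num.Theory.
Local Open Scope classical_set_scope.
Local Open Scope ring_scope.

(* The item of rank i + 1 is indexed by i : 'I_n and has value v i. *)
Definition item_values (R : realType) (n : nat) (v : 'I_n -> R) : Prop :=
  (forall i, 0 < v i) /\ (forall i j : 'I_n, (i < j)%N -> v j < v i).

(* s i is the item arriving at position i + 1. *)
Definition arrivals (R : realType) (n : nat) (v : 'I_n -> R) (s : 'S_n) :
    seq R :=
  [seq v (s i) | i <- enum 'I_n].

(* An algorithm maps the values, in order of arrival, to the accepted values,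
   in order of acceptance; values being distinct, they identify the items. *)
Definition algorithm (R : realType) : Type := seq R -> seq R.

(* The reference is meaningful when 1 <= r <= t - 1 <= size x. *)
Definition reference (R : realType) (t r : nat) (x : seq R) : R :=
  nth 0 (sort >=%R (take t.-1 x)) r.-1.

Definition single_ref (R : realType) (k t r : nat) : algorithm R := fun x =>
  take k [seq y <- drop t.-1 x | reference t r x < y].

Definition expectation (R : realType) (n : nat) (X : 'S_n -> R) : R :=
  (\sum_(s : 'S_n) X s) / (n`!)%:R.

Definition probability (R : realType) (n : nat) (E : pred 'S_n) : R :=
  #|[set s | E s]%SET|%:R / (n`!)%:R.

Definition ALG (R : realType) (n : nat) (A : algorithm R) (v : 'I_n -> R)
    (s : 'S_n) : R :=
  \sum_(y <- A (arrivals v s)) y.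

Definition OPT (R : realType) (n k : nat) (v : 'I_n -> R) : R :=
  \sum_(i < n | (i < k)%N) v i.

Definition competitive_ratio (R : realType) (n k : nat) (A : algorithm R) : R :=
  inf [set expectation (ALG A v) / OPT k v | v in @item_values R n].

(* j counts from 1. *)
Definition accept_prob (R : realType) (n : nat) (A : algorithm R)
    (v : 'I_n -> R) (i : 'I_n) (j : nat) : R :=
  probability R (fun s : 'S_n => onth (A (arrivals v s)) j.-1 == Some (v i)).

Definition gamma (k r j : nat) : nat :=
  if (j <= k - r + 1)%N then (r + 2 * (j - 1))%N else k.

(* Main.v *)
(* Count permutations according to the item x used as reference. Exchanging the
   labels of two items better than x changes neither the reference nor the
   positions of the candidates, so each of the items better than x is equally
   likely to be the j-th candidate. Summing over x, the probability that item i
   (from 0) is accepted in j-th place (from 0) is F (max (i, j + r - 1)) for a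
   nonincreasing F that does not depend on the values. Hence the probability
   p i of accepting item i is nonincreasing in i, Chebyshev's sum inequality
   gives E[ALG] >= (p 0 + ... + p (k - 1)) / k * OPT, and the values
   [i < k] + d (n - i) with d -> 0 show that this factor is optimal. Collecting
   equal values of F in the double sum over i, j < k produces gamma. *)
Require Import Defs.
From mathcomp Require Import all_boot all_order all_fingroup all_algebra.
From mathcomp Require Import classical_sets reals.
From mathcomp Require Import zify ring lra.

Set Implicit Arguments.
Unset Strict Implicit.
Unset Printing Implicit Defensive.

Import Order.TTheory GRing.Theory Num.Theory.
Local Open Scope ring_scope.

(** * The reference item and the candidates, in terms of ranks *)

Definition order_of {n : nat} (s : 'S_n) : seq 'I_n :=
  [seq s i | i <- enum 'I_n].

(* With m = t - 1 and q = r - 1, as in the definitions below; the default value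
   is reached only if q >= m. *)
Definition ref_item {n : nat} (hn : (0 < n)%N) (m q : nat) (s : 'S_n) : 'I_n :=
  nth (Ordinal hn) (sort <=%O (take m (order_of s))) q.

Definition candidates {n : nat} (m : nat) (s : 'S_n) (x : 'I_n) : seq 'I_n :=
  [seq y : 'I_n <- drop m (order_of s) | (y < x)%N].

Lemma item_values_mono {R : realType} {n : nat} {v : 'I_n -> R} :
  item_values v -> {mono v : x y / (x <= y)%O >-> y <= x}.
Proof.
by move=> [_ hv] x y; apply: (le_nmono (f := v)) => {}y {}x; apply: hv.
Qed.

Lemma item_values_inj {R : realType} {n : nat} {v : 'I_n -> R} :
  item_values v -> injective v.
Proof.
by move=> hv x y xy; apply: le_anti; rewrite -!(item_values_mono hv) xy lexx.
Qed.

Lemma uniq_order_of {n : nat} (s : 'S_n) : uniq (order_of s).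
Proof. by rewrite (map_inj_uniq (@perm_inj _ s)) enum_uniq. Qed.

Lemma size_order_of {n : nat} (s : 'S_n) : size (order_of s) = n.
Proof. by rewrite size_map size_enum_ord. Qed.

Lemma order_of_mulg {n : nat} (s p : 'S_n) :
  order_of (s * p)%g = map p (order_of s).
Proof. by rewrite /order_of -map_comp; apply: eq_map => i /=; rewrite permM. Qed.

Lemma count_lt_order_of {n : nat} (s : 'S_n) (x : 'I_n) :
  count (fun y : 'I_n => (y < x)%N) (order_of s) = x.
Proof.
have /seq.permP -> : perm_eq (order_of s) (enum 'I_n).
  apply: uniq_perm; rewrite ?uniq_order_of ?enum_uniq // => y.
  rewrite mem_enum inE; apply/mapP; exists (s^-1 y)%g; rewrite ?mem_enum //.
  by rewrite permKV.
rewrite -(count_map (fun y : 'I_n => val y) (fun y => y < x)%N) val_enum_ord.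
rewrite -size_filter -[in RHS](size_iota 0 x) -[in RHS](@filter_predT _ (iota 0 x)).
congr size; have le_xn : (x <= n)%N := ltnW (ltn_ord x).
have -> : iota 0 n = iota 0 x ++ iota x (n - x) by rewrite -iotaD subnKC.
rewrite filter_cat [X in _ ++ X](_ : _ = [::]) ?cats0.
  by apply: eq_in_filter => y; rewrite mem_iota.
apply/eqP; rewrite -size_eq0 size_filter -leqn0 leqNgt -has_count.
by apply/hasPn => y; rewrite mem_iota /= -leqNgt => /andP[].
Qed.

(** Replacing the sorted sample by a count makes the effect of relabelling items easy to follow. *)
Lemma ref_itemP {n : nat} (hn : (0 < n)%N) (m q : nat) (s : 'S_n) (x : 'I_n) :
  (q < m <= n)%N ->
  (ref_item hn m q s == x) =
  (x \in take m (order_of s)) &&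
  (count (fun y : 'I_n => (y < x)%N) (take m (order_of s)) == q).
Proof.
move=> /andP[qm mn]; set u := take m _.
have su : size u = m by rewrite size_takel // size_order_of.
have uu : uniq u by rewrite take_uniq // uniq_order_of.
have cE (y : 'I_n) : count (fun z : 'I_n => (z < y)%N) u = count (< y)%O (sort <=%O u).
  by rewrite (seq.permP (permEl (perm_sort <=%O u))).
rewrite cE; apply/eqP/andP => [<-|[xu /eqP cx]].
  have qs : (q < size (sort <=%O u))%N by rewrite size_sort su.
  split; first by rewrite -(mem_sort <=%O%O) mem_nth.
  by rewrite /ref_item count_lt_nth // sort_lt_sorted.
apply: nth_count_eq; rewrite ?sort_le_sorted // cx leqnn /=.
by rewrite -cx count_lt_le_mem mem_sort.
Qed.

(** Exactly [q] of the items better than the reference lie in the sample; all others arrive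
    later. *)
Lemma size_candidates {n : nat} (hn : (0 < n)%N) (m q : nat) (s : 'S_n) :
  (q < m <= n)%N ->
  size (candidates m s (ref_item hn m q s)) = (ref_item hn m q s - q)%N.
Proof.
move=> hq; set x := ref_item _ _ _ _.
have /andP[_ /eqP cx] := etrans (esym (ref_itemP hn s x hq)) (eqxx x).
rewrite size_filter; have := count_lt_order_of s x.
rewrite -{1}(cat_take_drop m (order_of s)) count_cat cx => xE.
by apply/eqP; rewrite eq_sym -(eqn_add2l q) xE subnKC ?eqxx // -xE leq_addr.
Qed.

(** * Exchange symmetry among the items better than the reference *)

Lemma ref_item_mulg_tperm {n : nat} (hn : (0 < n)%N) (m q : nat) (s : 'S_n)
    (x i i' : 'I_n) :
  (q < m <= n)%N -> (i < x)%N -> (i' < x)%N ->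
  (ref_item hn m q (s * tperm i i')%g == x) = (ref_item hn m q s == x).
Proof.
move=> hq ix i'x; rewrite !ref_itemP // order_of_mulg -map_take count_map.
have tx : tperm i i' x = x by rewrite tpermD // neq_ltn ?ix ?i'x.
rewrite -{1}tx (mem_map (@perm_inj _ _)); congr (_ && (_ == _)).
(* The transposition permutes the items better than [x] among themselves. *)
by apply: eq_count => y /=; case: tpermP => [->|->|//]; rewrite ix i'x.
Qed.

Lemma candidates_mulg_tperm {n : nat} (m : nat) (s : 'S_n) (x i i' : 'I_n) :
  (i < x)%N -> (i' < x)%N ->
  candidates m (s * tperm i i')%g x = map (tperm i i') (candidates m s x).
Proof.
move=> ix i'x; rewrite /candidates order_of_mulg -map_drop filter_map.
congr map; apply: eq_filter => y /=.
by case: tpermP => [->|->|//]; rewrite ix i'x.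
Qed.

Definition ref_count {n : nat} (hn : (0 < n)%N) (m q : nat) (x : 'I_n) : nat :=
  #|[set s : 'S_n | ref_item hn m q s == x]|.

(* j counts from 0. *)
Definition accept_count {n : nat} (hn : (0 < n)%N) (m q : nat)
    (x i : 'I_n) (j : nat) : nat :=
  #|[set s : 'S_n | (ref_item hn m q s == x) &&
                    (onth (candidates m s x) j == Some i)]|.

(** Right multiplication relabels items and keeps positions, so multiplying by [tperm i i'] is a
    bijection between the two sets counted. *)
Lemma accept_count_swap {n : nat} (hn : (0 < n)%N) (m q : nat)
    (x i i' : 'I_n) (j : nat) :
  (q < m <= n)%N -> (i < x)%N -> (i' < x)%N ->
  accept_count hn m q x i j = accept_count hn m q x i' j.
Proof.
move=> hq ix i'x; rewrite /accept_count.
rewrite -(card_imset _ (mulIg (tperm i i'))); congr #|pred_of_set _|.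
apply/setP => s; rewrite inE; apply/imsetP/idP => [[s' + ->]|].
  rewrite inE ref_item_mulg_tperm // => /andP[->] /eqP /=.
  by rewrite candidates_mulg_tperm // onth_map => ->; rewrite /= tpermL.
move=> /andP[sx /eqP sj]; exists (s * tperm i i')%g; last first.
  by rewrite -mulgA tperm2 mulg1.
rewrite inE ref_item_mulg_tperm // sx candidates_mulg_tperm // onth_map sj /=.
by rewrite tpermR.
Qed.

Lemma accept_count0 {n : nat} (hn : (0 < n)%N) (m q : nat)
    (x i : 'I_n) (j : nat) :
  (x <= i)%N -> accept_count hn m q x i j = 0%N.
Proof.
move=> xi; apply/eqP; rewrite cards_eq0; apply/eqP/setP => s.
rewrite !inE; apply/negP => /andP[_ /eqP sj].
have : i \in candidates m s x by apply/onthP; exists j.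
by rewrite mem_filter ltnNge xi.
Qed.

(** Double counting: a permutation with reference [x] has [x - q] candidates, hence one candidate
    numbered [j] if [j < x - q] and none otherwise. *)
Lemma sum_accept_count {n : nat} (hn : (0 < n)%N) (m q : nat)
    (x : 'I_n) (j : nat) :
  (q < m <= n)%N ->
  (\sum_(i < n) accept_count hn m q x i j)%N =
  if (j < x - q)%N then ref_count hn m q x else 0%N.
Proof.
move=> hq; rewrite /accept_count.
under eq_bigr => i _ do rewrite -sum1_card big_mkcond /=.
rewrite exchange_big /= -[RHS](_ : (\sum_(s : 'S_n)
  if ref_item hn m q s == x then (j < x - q : nat) else 0)%N = _); last first.
  rewrite -big_mkcond /= sum_nat_const /ref_count cardsE.
  by case: ifP; rewrite ?muln1 ?muln0.
apply: eq_bigr => s _; under eq_bigr => i _ do rewrite inE.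
case: eqP => [<-|_] /=; last by rewrite big1.
rewrite -(size_candidates hn s hq) -onthTE.
case: (onth _ j) => [i|] /=; last by rewrite big1.
rewrite (bigD1 i) //= eqxx big1 // => i' i'i.
by rewrite (inj_eq Some_inj) eq_sym (negbTE i'i).
Qed.

Lemma accept_countE {n : nat} (hn : (0 < n)%N) (m q : nat)
    (x i : 'I_n) (j : nat) :
  (q < m <= n)%N -> (i < x)%N ->
  (x * accept_count hn m q x i j)%N =
  if (j < x - q)%N then ref_count hn m q x else 0%N.
Proof.
move=> hq ix; rewrite -sum_accept_count //.
rewrite (bigID (fun i' : 'I_n => (i' < x)%N)) /= [X in (_ + X)%N]big1 ?addn0.
  rewrite (eq_bigr (fun=> accept_count hn m q x i j)); last first.
    by move=> i' i'x; apply: accept_count_swap.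
  rewrite -(big_ord_widen _ (fun=> accept_count hn m q x i j) (ltnW (ltn_ord x))).
  by rewrite sum_nat_const card_ord.
by move=> i'; rewrite -leqNgt => /accept_count0.
Qed.

(** * Acceptance probabilities and the expected value *)

Lemma single_ref_arrivals (R : realType) (n k t r : nat) (hn : (0 < n)%N)
    (v : 'I_n -> R) (s : 'S_n) :
  item_values v -> (r.-1 < t.-1 <= n)%N ->
  single_ref k t r (arrivals v s) =
  map v (take k (candidates t.-1 s (ref_item hn t.-1 r.-1 s))).
Proof.
move=> /item_values_mono vm /andP[qm mn]; rewrite /single_ref.
have -> : arrivals v s = map v (order_of s) by rewrite -[RHS]map_comp.
have -> : reference t r (map v (order_of s)) = v (ref_item hn t.-1 r.-1 s).
  have vm' : {mono v : x y / (x <= y)%O >-> x >= y} by move=> x y; rewrite /= vm.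
  rewrite /reference -map_take -(map_sort vm').
  by rewrite (nth_map (Ordinal hn)) // size_sort size_takel // size_order_of.
rewrite -map_drop filter_map map_take; congr (take _ (map _ _)).
by apply: eq_filter => y /=; rewrite (leW_nmono (f := v) (fun x y => vm y x)).
Qed.

(** The function F, as a sum over references [x]: the probability of [x] times the chance 1/x that a
    given better item is the candidate in question. *)
Definition ref_tail (R : realType) (n : nat) (hn : (0 < n)%N)
    (m q l : nat) : R :=
  (\sum_(x < n | (l <= x)%N) (ref_count hn m q x)%:R / x%:R) / n`!%:R.

Lemma accept_probE (R : realType) (n k t r : nat) (hn : (0 < n)%N)
    (v : 'I_n -> R) (i : 'I_n) (j : nat) :
  item_values v -> (r.-1 < t.-1 <= n)%N -> (j < k)%N ->
  accept_prob (single_ref k t r) v i j.+1 =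
  ref_tail R hn t.-1 r.-1 (maxn i (j + r.-1)).+1.
Proof.
move=> hv hq jk; have vinj := item_values_inj hv.
rewrite /accept_prob /probability /ref_tail; congr (_ / _).
rewrite -sum1_card (partition_big (ref_item hn t.-1 r.-1) predT) //= natr_sum.
rewrite [RHS]big_mkcond /=; apply: eq_bigr => x _.
have -> : (\sum_(s in [set s | onth (single_ref k t r (arrivals v s)) j ==
    Some (v i)] | ref_item hn t.-1 r.-1 s == x) 1)%N =
    accept_count hn t.-1 r.-1 x i j.
  rewrite /accept_count -sum1_card; apply: eq_bigl => s; rewrite !inE andbC.
  case: eqP => //= <-; rewrite (single_ref_arrivals _ hn _ hv hq) onth_map.
  rewrite onthE map_take nth_take // -onthE.
  case: (onth _ j) => //= y.
  by rewrite !(inj_eq Some_inj) (inj_eq vinj).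
(* Item [i] must beat the reference, [i < x], and a candidate numbered [j] must exist,
   [j + r.-1 < x]; the maximum combines both conditions. *)
rewrite gtn_max; case: ltnP => [ix|xi] /=; last by rewrite accept_count0.
have x0 : (x%:R : R) != 0 by rewrite pnatr_eq0 -lt0n (leq_ltn_trans _ ix).
apply: (mulfI x0); rewrite -natrM accept_countE // ltn_subRL addnC.
by case: ifP => _; rewrite ?mulr0 // mulrCA divff ?mulr1.
Qed.

(** Turns the value of the accepted list into indicators of acceptance in each place, whose
    expectations are acceptance probabilities. *)
Lemma sum_onth (R : nzRingType) (I : finType) (f : I -> R) (u : seq I) (k : nat) :
  (size u <= k)%N ->
  \sum_(i <- u) f i = \sum_i f i * \sum_(j < k) (onth u j == Some i)%:R.
Proof.
elim: u k => [|y u IHu] k /=.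
  by move=> _; rewrite big_nil big1 // => i _; rewrite big1 ?mulr0 // => -[[]].
case: k => // k; rewrite ltnS big_cons => /IHu ->.
under [RHS]eq_bigr => i _ do rewrite big_ord_recl mulrDr.
rewrite big_split /=; congr (_ + _).
rewrite (bigD1 y) //= eqxx mulr1 big1 ?addr0 // => i iy.
by rewrite (inj_eq Some_inj) eq_sym (negbTE iy) mulr0.
Qed.

Lemma expectation_single_ref (R : realType) (n k t r : nat) (hn : (0 < n)%N)
    (v : 'I_n -> R) :
  item_values v -> (r.-1 < t.-1 <= n)%N ->
  expectation (ALG (single_ref k t r) v) =
  \sum_(i < n) v i *
    \sum_(j < k) ref_tail R hn t.-1 r.-1 (maxn i (j + r.-1)).+1.
Proof.
move=> hv hq; have vinj := item_values_inj hv.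
rewrite /expectation /ALG.
pose L s := take k (candidates t.-1 s (ref_item hn t.-1 r.-1 s)).
have AL s : single_ref k t r (arrivals v s) = map v (L s).
  exact: single_ref_arrivals.
under eq_bigr => s _.
  rewrite AL big_map (@sum_onth _ _ _ _ k); last first.
    by rewrite size_take; case: ltnP => // /ltnW.
  over.
rewrite exchange_big /= mulr_suml; apply: eq_bigr => i _.
rewrite -mulr_sumr -mulrA; congr (_ * _).
rewrite exchange_big /= mulr_suml; apply: eq_bigr => j _.
rewrite -(accept_probE hn i hv hq (ltn_ord j)) /accept_prob /probability.
congr (_ / _); rewrite -sum1_card natr_sum [RHS]big_mkcond /=.
apply: eq_bigr => s _; rewrite inE AL onth_map.
case: (onth _ j) => //= y; rewrite !(inj_eq Some_inj) (inj_eq vinj).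
by case: eqP.
Qed.

(** * From nonincreasing acceptance probabilities to the competitive ratio *)

Lemma sum_chebyshev (R : realFieldType) (I : finType) (P : pred I) (f g : I -> R) :
  (forall i j, P i -> P j -> 0 <= (f i - f j) * (g i - g j)) ->
  (\sum_(i | P i) f i) * (\sum_(i | P i) g i) <=
  #|P|%:R * \sum_(i | P i) f i * g i.
Proof.
move=> fg; set F := \sum_(i | P i) f i; set G := \sum_(i | P i) g i.
set N := #|P|%:R; set S := \sum_(i | P i) _ * _.
(* This double sum expands to [2 * (N * S - F * G)]. *)
have : 0 <= \sum_(i | P i) \sum_(j | P j) (f i - f j) * (g i - g j).
  by do 2!(apply: sumr_ge0 => ? ?); apply: fg.
have -> : \sum_(i | P i) \sum_(j | P j) (f i - f j) * (g i - g j) =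
    \sum_(i | P i) (N * (f i * g i) + S - (f i * G + F * g i)).
  apply: eq_bigr => i _; rewrite mulr_sumr mulr_suml /N.
  rewrite -sum1_card natr_sum mulr_suml /S -!big_split -sumrB /=.
  by apply: eq_bigr => j _; ring.
rewrite sumrB !big_split /= -!mulr_sumr -mulr_suml sumr_const -/S -/F -/G.
rewrite -[S *+ _]mulr_natl -/N; lra.
Qed.

Lemma competitive_ratio_linear (R : realType) (n k : nat) (A : algorithm R)
    (p : nat -> R) :
  (0 < k <= n)%N -> (forall i, 0 <= p i) ->
  (forall i j, (i <= j)%N -> p j <= p i) ->
  (forall v : 'I_n -> R, item_values v ->
    expectation (ALG A v) = \sum_(i < n) v i * p i) ->
  competitive_ratio n k A = k%:R^-1 * \sum_(i < k) p i.
Proof.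
move=> /andP[k0 kn] p0 pmono EA.
have k0R : 0 < k%:R :> R by rewrite ltr0n.
have OPT0 (v : 'I_n -> R) : item_values v -> 0 < OPT k v.
  move=> [v0 _]; rewrite /OPT (bigD1 (Ordinal (leq_trans k0 kn))) //=.
  by rewrite ltr_pwDl // sumr_ge0 // => i _; rewrite ltW.
set c := _ * _.
have lb : lbound
    [set expectation (ALG A v) / OPT k v | v in @item_values R n]%classic c.
  move=> _ [v hv <-]; rewrite ler_pdivlMr ?OPT0 // EA // /c -mulrA.
  rewrite ler_pdivrMl // (big_ord_widen _ _ kn) /OPT.
  apply: le_trans (sum_chebyshev _) _ => [i j ik jk|].
    have [ij|ji] := leqP i j.
      rewrite mulr_ge0 ?subr_ge0 ?pmono //.
      by rewrite (item_values_mono hv).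
    rewrite mulr_le0 ?subr_le0 ?pmono ?(ltnW ji) //.
    by rewrite (item_values_mono hv); apply: ltnW.
  rewrite -sum1_card natr_sum -(big_ord_widen _ (fun=> 1) kn) sumr_const card_ord.
  rewrite ler_wpM2l ?ler0n // [leLHS]big_mkcond /=; apply: ler_sum => i _.
  by case: ifP => _; rewrite mulrC // mulr_ge0 // ltW //; case: hv.
(* The [d] term makes the indicator of the top [k] items positive and strictly decreasing. *)
have ne (d : R) : 0 < d ->
    item_values (fun i : 'I_n => (i < k)%N%:R + d * (n - i)%:R).
  move=> d0; split => [i|i j ij].
    by rewrite ltr_wpDl ?ler0n // mulr_gt0 // ltr0n subn_gt0.
  rewrite ler_ltD // ?ltr_pM2l // ?ler_nat ?ltr_nat; last first.
    by rewrite ltn_sub2l.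
  by case: (ltnP j k) => // jk; rewrite (ltn_trans ij jk).
apply/le_anti/andP; split; last first.
  by apply: lb_le_inf => //; eexists; eexists; first exact: (ne 1).
apply/ler_addgt0Pr => e e0.
(* The perturbation contributes [d * M] to the expectation, and [d] is chosen so that
   [d * M <= e * k]; the 1 in [M + 1] keeps the denominator positive. *)
pose M := \sum_(i < n) (n - i)%:R * p i.
have M0 : 0 <= M by apply: sumr_ge0 => i _; rewrite mulr_ge0.
pose d := e * k%:R / (M + 1).
have d0 : 0 < d by rewrite divr_gt0 ?mulr_gt0 // ltr_wpDl.
have inf_le := ge_inf (ex_intro _ c lb) (ex_intro2 _ _ _ (ne d d0) erefl).
apply: le_trans inf_le _.
rewrite (ler_pdivrMr _ _ (OPT0 _ (ne d d0))) (EA _ (ne d d0)).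
apply: (@le_trans _ _ (\sum_(i < k) p i + d * M)).
  under eq_bigr => i _ do rewrite mulrDl -mulrA.
  rewrite big_split /= -mulr_sumr lerD2r (big_ord_widen _ _ kn).
  rewrite [leRHS]big_mkcond /=; apply: ler_sum => i _.
  by case: ifP; rewrite ?mul1r ?mul0r.
apply: (@le_trans _ _ ((c + e) * k%:R)).
  rewrite mulrDl {1}/c [_ * _ * _]mulrC mulVKf ?gt_eqF // lerD2l /d.
  rewrite mulrAC ler_pdivrMr ?ltr_wpDl // ler_wpM2l ?mulr_ge0 ?ler0n // ?ltW //.
  by rewrite ltrDl.
have ce0 : 0 <= c + e.
  by rewrite addr_ge0 ?mulr_ge0 ?invr_ge0 ?sumr_ge0 // ltW.
apply: ler_wpM2l ce0 _ _ _.
(* Each of the top [k] items is worth at least 1, so [OPT] is at least [k]. *)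
rewrite /OPT big_split /= -[leLHS]addr0 lerD //.
  rewrite (eq_bigr (fun=> 1)) => [|i ->//].
  by rewrite -(big_ord_widen _ (fun=> 1) kn) sumr_const card_ord.
by rewrite sumr_ge0 // => i _; rewrite mulr_ge0 // ltW.
Qed.

(** * Collecting equal terms into [gamma] *)

Lemma sum_maxn_gamma (R : pzRingType) (G : nat -> R) (k q : nat) :
  (q < k)%N ->
  \sum_(i < k) \sum_(j < k) G (maxn i (j + q)) =
  \sum_(j < k) (gamma k q.+1 j.+1)%:R * G (j + q)%N.
Proof.
move=> qk; rewrite exchange_big /=.
(* For fixed [j] the maximum is [j + q] for the [minn k (j + q).+1] indices [i <= j + q]; each
   larger [i] is written [l + q] with [j < l]. *)
have splitG j : \sum_(i < k) G (maxn i (j + q)) =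
    (minn k (j + q).+1)%:R * G (j + q)%N +
    \sum_(l < k) if (l + q < k)%N && (j < l)%N then G (l + q)%N else 0.
  rewrite (eq_bigr (fun i : 'I_k =>
      (if (i < (j + q).+1)%N then G (j + q)%N else 0) +
      if (j + q < i)%N then G i else 0)); last first.
    move=> i _; case: ltnP => h; first by rewrite addr0 (maxn_idPr (h : i <= j + q)%N).
    by rewrite add0r (maxn_idPl (ltnW h)).
  rewrite big_split /=; congr (_ + _).
    rewrite -big_mkcond /= mulr_natl.
    rewrite (eq_bigl (fun i : 'I_k => (i < minn k (j + q).+1)%N)); last first.
      by move=> i; rewrite leq_min ltn_ord.
    rewrite -(big_ord_widen _ (fun=> G (j + q)%N) (geq_minl _ _)).
    by rewrite sumr_const card_ord.
  rewrite -(big_mkord predT (fun i => if (j + q < i)%N then G i else 0)).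
  rewrite (big_cat_nat (n := q)) ?(ltnW qk) //= big_nat big1 ?add0r; last first.
    by move=> i /andP[_ iq]; rewrite ltnNge (leq_trans (ltnW iq)) ?leq_addl.
  rewrite -{1}[q]add0n big_addn (big_nat_widen _ _ k) ?leq_subr // big_mkord.
  rewrite [LHS]big_mkcond; apply: eq_bigr => l _ /=.
  by rewrite ltn_subRL addnC ltn_add2r; case: ifP.
under eq_bigr => j _ do rewrite splitG.
(* If [l + q < k], then [G (l + q)] occurs [l + q + 1] times in the first part and once for each
   [j < l] in the second, so [q.+1 + 2 * l] times in all. Otherwise only the first part contributes,
   [k] times. *)
rewrite big_split /= [X in _ + X]exchange_big -big_split /=.
apply: eq_bigr => l _; rewrite /gamma.
rewrite (_ : (l.+1 <= k - q.+1 + 1)%N = (l + q < k)%N); last by lia.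
case: ltnP => lk /=; last first.
  by rewrite big1 // addr0; congr (_%:R * _); lia.
rewrite -big_mkcond /= -(big_ord_widen _ (fun=> G (l + q)%N) (ltnW (ltn_ord l))).
rewrite sumr_const card_ord -[_ *+ l]mulr_natl -mulrDl -natrD.
by congr (_%:R * _); lia.
Qed.

Lemma ref_tail_ge0 (R : realType) (n : nat) (hn : (0 < n)%N) (m q l : nat) :
  0 <= ref_tail R hn m q l.
Proof.
rewrite mulr_ge0 ?invr_ge0 ?ler0n // sumr_ge0 // => x _.
by rewrite mulr_ge0 ?invr_ge0 ?ler0n.
Qed.

Lemma ref_tail_le (R : realType) (n : nat) (hn : (0 < n)%N) (m q l l' : nat) :
  (l <= l')%N -> ref_tail R hn m q l' <= ref_tail R hn m q l.
Proof.
move=> ll'; rewrite ler_wpM2r ?invr_ge0 // [leLHS]big_mkcond [leRHS]big_mkcond.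
apply: ler_sum => x _; case: ifP => [l'x|_]; first by rewrite (leq_trans ll').
by case: ifP => _; rewrite ?mulr_ge0 ?invr_ge0 ?ler0n.
Qed.

Theorem theorem10 (R : realType) (n k r t : nat) (hn : (0 < n)%N)
    (hk : (0 < k)%N) (hr : (1 <= r <= k)%N) (ht : (k < t <= n - k)%N)
    (v : 'I_n -> R) (hv : item_values v) :
  competitive_ratio n k (single_ref k t r) =
  (k%:R)^-1 * \sum_(1 <= j < k.+1)
    (gamma k r j)%:R * accept_prob (single_ref k t r) v (Ordinal hn) j.
Proof.
have hq : (r.-1 < t.-1 <= n)%N by lia.
rewrite (competitive_ratio_linear (p := fun i =>
    \sum_(j < k) ref_tail R hn t.-1 r.-1 (maxn i (j + r.-1)).+1)).
- congr (_ * _).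
  rewrite (sum_maxn_gamma (fun i => ref_tail R hn _ _ i.+1)); last by lia.
  rewrite big_add1 big_mkord; apply: eq_bigr => j _.
  (* The best item has index 0, so its maximum is [j + r.-1], the argument left after collecting
     terms. *)
  by rewrite (accept_probE hn _ hv hq) // max0n prednK //; lia.
- by lia.
- by move=> i; apply: sumr_ge0 => j _; apply: ref_tail_ge0.
- move=> i i' ii'; apply: ler_sum => j _; apply: ref_tail_le.
  by rewrite ltnS geq_max leq_maxr leq_max ii'.
by move=> w hw; rewrite (expectation_single_ref _ hn hw hq).
Qed.
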